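(* Let $n\ge3$, $s\ge2$ and $j\ge2$ be integers with $s\ge\lceil n/j\rceil$. Then $s(n-j)\le TC_s(C\Omega_n)$.
   Context: $C\Omega_n$ is (a cubical structure on) the anchored configuration space of the circle with two anchored points: the subspace of $(S^1)^n$ consisting of all tuples $(p_1,\dots,p_n)$ with $S\subseteq\{p_1,\dots,p_n\}$, where $S\subset S^1$ is a fixed set of two points. Concretely, its cells are the tuples $(x_1,y_1,x_2,y_2,x_3,y_3,x_4,y_4)$ of pairwise disjoint sets with union $\{1,\dots,n\}$ and $x_3\ne\emptyset\neq x_4$, of dimension $\sum_i|y_i|$, describing $n$ labelled points on the cycle graph $C_4$ ($x_i$: points at vertex $i$; $y_i$: points in the open edge from vertex $i$ to vertex $i+1$, indices mod 4), with vertices 3 and 4 being the anchored points. For $s\ge2$ and a path-connected space $X$, $TC_s(X)$ is the (reduced) $s$th topological complexity: $TC_s(X)+1$ is the smallest number of open sets covering $X^s$ on each of which the map $e_s:PX\to X^s$, $e_s(\gamma)=\left(\gamma\left(\frac{0}{s-1}\right),\gamma\left(\frac{1}{s-1}\right),\dots,\gamma\left(\frac{s-1}{s-1}\right)\right)$, admits a continuous section, where $PX$ is the space of continuous paths $[0,1]\to X$. *)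

(* Defs.v *)
From HB Require Import structures.
From mathcomp Require Import all_boot all_order all_algebra.
From mathcomp Require Import all_classical all_reals all_analysis.
Set Implicit Arguments.
Unset Strict Implicit.
Unset Printing Implicit Defensive.
Import Order.TTheory GRing.Theory Num.Theory.
Import numFieldNormedType.Exports.
Local Open Scope classical_set_scope.
Local Open Scope ring_scope.

(* A set A used as a type is [set_type A], with the subspace topology; finite
   powers X^s are {ptws 'I_s -> X}, with the product topology. *)

Definition unit_interval (R : realType) : topologicalType :=
  set_type (`[0, 1] : set R).

Section PathSpace.
(* gives [continuousType U V] the compact-open topology *)
Import ArrowAsCompactOpen.

Definition path_space (R : realType) (X : topologicalType) : topologicalType :=
  continuousType (unit_interval R) X.

End PathSpace.

Fact stop_time_subproof (R : realType) (s : nat) (i : 'I_s) :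
  (i%:R / s.-1%:R : R) \in (`[0, 1]%classic : set R).
Proof.
apply: mem_set; rewrite /= in_itv /= divr_ge0 ?ler0n //=.
case: s i => [[]//|s] i /=; have := leq_ord i.
by case: s i => [|s] i ile; rewrite ?invr0 ?mulr0 ?ler01//
   ler_pdivrMr ?ltr0n// mul1r ler_nat.
Qed.

Definition stop_time (R : realType) (s : nat) (i : 'I_s) : unit_interval R :=
  exist _ (i%:R / s.-1%:R) (stop_time_subproof R i).

Definition path_eval (R : realType) (s : nat) (X : topologicalType)
    (g : path_space R X) : {ptws 'I_s -> X} :=
  fun i => (g : continuousType _ _) (stop_time R i).

Arguments path_eval {R} s {X} g.

Definition has_local_section (R : realType) (s : nat) (X : topologicalType)
    (U : set {ptws 'I_s -> X}) : Prop :=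
  exists sigma : set_type U -> path_space R X,
    continuous sigma /\ forall x : set_type U, path_eval s (sigma x) = set_val x.

Definition has_motion_planner (R : realType) (s : nat) (X : topologicalType)
    (m : nat) : Prop :=
  exists U : 'I_m -> set {ptws 'I_s -> X},
    [/\ forall k, open (U k),
        \bigcup_(k in [set: 'I_m]) U k = [set: {ptws 'I_s -> X}] &
        forall k, has_local_section R (U k)].

(* The value is +oo when no finite cover exists. *)
Definition TC (R : realType) (s : nat) (X : topologicalType) : \bar R :=
  (ereal_inf [set (m%:R)%:E | m in [set m | has_motion_planner R s X m]] - 1)%E.

Definition circle (R : realType) : topologicalType :=
  set_type [set z : R * R | z.1 ^+ 2 + z.2 ^+ 2 = 1].

Definition anchored_config (R : realType) (n : nat) (S : set (circle R)) :
    topologicalType :=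
  set_type [set p : {ptws 'I_n -> circle R} | S `<=` range p].

(* Main.v *)
(* Freeze in the k-th factor a block of j coordinates, containing both anchors,
   so that the s blocks cover all the indices; the s(n-j) remaining coordinates
   sweep out a torus in X^s. Over an open set carrying a local section, the
   coordinate i of the k-th factor is homotopic to the coordinate i of a factor
   where i is frozen, i.e. to a constant, so it has a real logarithm there. If
   m <= s(n-j) such sets U_l covered X^s, restrict to an m-torus and use on U_l
   only a logarithm of the l-th coordinate x_l: the difference between x_l and
   this logarithm is locally constant on the preimage of U_l in R^m, at bounded
   distance from x_l. Its sign labels the vertices of a fine grid, and the
   discrete Poincare-Miranda theorem yields a cube on which all m signs change,
   whereas the l-th sign is constant on a small cube contained in U_l. *)

Require Import Defs.
From HB Require Import structures.
From mathcomp Require Import all_boot all_order all_algebra.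
From mathcomp Require Import ring lra zify.
From mathcomp Require Import all_classical all_reals all_analysis.
Set Implicit Arguments.
Unset Strict Implicit.
Unset Printing Implicit Defensive.
Import Order.TTheory GRing.Theory Num.Theory.
Import numFieldNormedType.Exports.
Local Open Scope classical_set_scope.
Local Open Scope ring_scope.

(** * A discrete Poincare-Miranda theorem *)

Lemma F2_addrr (x : 'F_2) : x + x = 0.
Proof. by apply/val_inj; case: x => [[|[|[]]]]. Qed.

Lemma F2_addr_eq0 (x y : 'F_2) : x + y = 0 -> x = y.
Proof. by move=> xy; rewrite -[LHS]addr0 -(F2_addrr y) addrA xy add0r. Qed.

Lemma exchange_offdiag (m : nat) (A : {set 'I_m}) (f : 'I_m -> 'I_m -> 'F_2) :
  \sum_(k in A) \sum_(k' in A :\ k) f k k' =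
  \sum_(k in A) \sum_(k' in A :\ k) f k' k.
Proof.
rewrite (exchange_big_dep [in A])/=; last by move=> i k _; rewrite !inE => /andP[].
apply: eq_bigr => k kA; apply: eq_bigl => k'.
by rewrite !inE kA andbT andbC eq_sym.
Qed.

(** The terms at [(k, k')] and [(k', k)] cancel mod 2. *)
Lemma sum_offdiag_sym (m : nat) (A : {set 'I_m}) (f : 'I_m -> 'I_m -> 'F_2) :
  (forall k k', k != k' -> f k k' = f k' k) ->
  \sum_(k in A) \sum_(k' in A :\ k) f k k' = 0.
Proof.
move=> fC.
rewrite (eq_bigr (fun k => \sum_(k' in A :\ k | (k < k')%N) f k k' +
    \sum_(k' in A :\ k | ~~ (k < k')%N) f k k')); last first.
  by move=> k _; rewrite (bigID (fun k' : 'I_m => (k < k')%N)).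
rewrite big_split /= [X in _ + X](exchange_big_dep [in A])/=; last first.
  by move=> i k _; rewrite !inE => /andP[/andP[]].
rewrite [X in _ + X](_ : _ =
  \sum_(k in A) \sum_(k' in A :\ k | (k < k')%N) f k k') ?F2_addrr//.
apply: eq_bigr => k kA; rewrite [RHS](eq_bigr (fun k' => f k' k)).
  apply: eq_bigl => k'; rewrite !inE kA -leqNgt leq_eqVlt eq_sym.
  rewrite -val_eqE /=.
  by case: (ltngtP k k') => _; rewrite ?andbF ?andbT //=.
by move=> k'; rewrite !inE => /andP[/andP[kk' _] _]; rewrite fC // eq_sym.
Qed.

(** * Cup products of label coboundaries on a cubical grid, mod 2 *)

Section CubicalSperner.
Variables (m K : nat).
Notation grid := {ffun 'I_m -> 'I_K.+1}.
Implicit Types (v w : grid) (A : {set 'I_m}) (L : seq 'I_m).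

(* [inord] sends the last index K back to 0, so [grid_up k v] is the neighbour
   of v only when v k < K. *)
Definition grid_up (k : 'I_m) v : grid :=
  [ffun i => if i == k then inord (v i).+1 else v i].

Lemma grid_upC k k' v : grid_up k (grid_up k' v) = grid_up k' (grid_up k v).
Proof.
apply/ffunP => i; rewrite !ffunE.
by have [->|] := eqVneq i k; have [->|] := eqVneq _ k'; rewrite ?eqxx// => /negbTE ->.
Qed.

Variable c : 'I_m -> grid -> 'F_2.

(* The value of the cup product [dc_(l1) \cup ... \cup dc_(lr)] mod 2 on the
   r-cube spanned at v by the directions in A: the sum over the Kuhn simplices
   of that cube. *)
Fixpoint cup_delta L A v : 'F_2 :=
  if L is l :: L' then
    \sum_(k in A) (c l (grid_up k v) + c l v)
                  * cup_delta L' (A :\ k) (grid_up k v)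
  else 1.

(* dc_(l1) \cup ... \cup dc_(lr) is a cocycle; no signs appear mod 2. *)
Lemma cup_delta_closed L A v :
  \sum_(k in A) (cup_delta L (A :\ k) (grid_up k v) + cup_delta L (A :\ k) v)
  = 0.
Proof.
elim: L A v => [|l L IH] A v /=.
  by rewrite big1// => k _; rewrite F2_addrr.
have setDC k k' : A :\ k :\ k' = A :\ k' :\ k by rewrite !finset.setDDl finset.setUC.
pose F k k' w := cup_delta L (A :\ k :\ k') w.
have FC k k' : F k k' = F k' k by rewrite /F setDC.
(* Of these four double sums the first is symmetric in [k], [k'] and vanishes. The second and third,
   after an exchange of [k] and [k'], combine into multiples of the inductive statement at
   [grid_up k v]. In the fourth, induction replaces [grid_up k' v] by [v], which leaves a symmetric
   sum. *)
rewrite (eq_bigr (fun k =>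
    \sum_(k' in A :\ k) (c l (grid_up k' (grid_up k v))
         * F k k' (grid_up k' (grid_up k v)))
  + \sum_(k' in A :\ k) (c l (grid_up k v) * F k k' (grid_up k' (grid_up k v)))
  + \sum_(k' in A :\ k) (c l (grid_up k' v) * F k k' (grid_up k' v))
  + c l v * \sum_(k' in A :\ k) F k k' (grid_up k' v))); last first.
  move=> k _; rewrite mulr_sumr -!big_split; apply: eq_bigr => k' _ /=.
  by rewrite !mulrDl !addrA.
rewrite !big_split/= sum_offdiag_sym ?add0r; last first.
  by move=> k k' _; rewrite FC grid_upC.
rewrite [X in _ + X + _]exchange_offdiag -big_split/= [X in X + _]big1.
  rewrite add0r -mulr_sumr (eq_bigr (fun k => \sum_(k' in A :\ k) F k k' v)).
    by rewrite sum_offdiag_sym ?mulr0// => k k' _; rewrite FC.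
  by move=> k _; apply: F2_addr_eq0; rewrite -big_split/=; exact: IH.
move=> k _; rewrite -big_split/=.
under eq_bigr do rewrite FC -mulrDr.
rewrite -mulr_sumr.
rewrite (eq_bigr (fun k' => cup_delta L (A :\ k :\ k') (grid_up k' (grid_up k v))
  + cup_delta L (A :\ k :\ k') (grid_up k v))) ?IH ?mulr0//.
by move=> k' _; rewrite FC.
Qed.

(** Leibniz rule dc_l \cup dc_(L) = d(c_l \cup dc_(L)): adding [c l v] times the closedness relation
    yields differences over opposite faces, which telescope over the grid. *)
Lemma cup_delta_cons l L A v : cup_delta (l :: L) A v =
  \sum_(k in A) (c l (grid_up k v) * cup_delta L (A :\ k) (grid_up k v)
                 + c l v * cup_delta L (A :\ k) v).
Proof.
have := congr1 ( *%R (c l v)) (cup_delta_closed L A v).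
rewrite mulr0 => zero; rewrite /= -[RHS]addr0 -{}[X in _ = _ + X]zero.
rewrite mulr_sumr -big_split; apply: eq_bigr => k _ /=.
rewrite mulrDl mulrDr -!addrA; congr (_ + _).
by rewrite [RHS]addrC -addrA F2_addrr addr0.
Qed.

(** Directions in [A] never change coordinate [k], so every vertex involved lies on the face where
    [c k] is constant, and the factor dc_k is zero. *)
Lemma cup_delta_face (k : 'I_m) (x : 'I_K.+1) L A v :
  (forall w w', w k = x -> w' k = x -> c k w = c k w') ->
  k \in L -> k \notin A -> v k = x -> cup_delta L A v = 0.
Proof.
move=> ckx; elim: L A v => // l L IH A v kL kA vk /=; apply: big1 => k' k'A.
have kk' : k != k' by apply: contraNneq kA => ->.
have uvk : grid_up k' v k = x by rewrite ffunE (negbTE kk').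
move: kL; rewrite in_cons => /orP[/eqP <-|kL].
  by rewrite (ckx _ v)// F2_addrr mul0r.
by rewrite (IH (A :\ k'))// ?mulr0// finset.in_setD1 (negbTE kA) andbF.
Qed.

Hypothesis K_gt0 : (0 < K)%N.

(** Lower corners of the unit cubes tiling the face on which the coordinates outside [A] equal
    [K]. *)
Definition in_box A v :=
  [forall i, if i \in A then (v i < K)%N else v i == ord_max].

(** Differences along [k] telescope: mod 2 only the end faces [v k = K] and [v k = 0] survive. *)
Lemma sum_in_box_up A k (h : grid -> 'F_2) : k \in A ->
  \sum_(v | in_box A v) (h (grid_up k v) + h v) =
  \sum_(v | in_box (A :\ k) v) h v
  + \sum_(v | in_box A v && (v k == ord0)) h v.
Proof.
move=> kA.
(* [Q] leaves coordinate [k] free; [grid_up k] maps its part [v k < K] bijectively onto its part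
   [v k != 0], with inverse [down]. *)
pose Q v := [forall i, (i == k) || (if i \in A then (v i < K)%N else v i == ord_max)].
pose down v : grid := [ffun i => if i == k then inord (v i).-1 else v i].
have inboxE v : in_box A v = Q v && (v k < K)%N.
  apply/forallP/andP => [bv|[/forallP qv vk] i].
    split; last by have := bv k; rewrite kA.
    by apply/forallP => i; rewrite bv orbT.
  by have [->|ik] := eqVneq i k; [rewrite kA | have := qv i; rewrite (negbTE ik)].
have inbox'E v : in_box (A :\ k) v = Q v && (v k == ord_max).
  apply/forallP/andP => [bv|[/forallP qv vk] i].
    split; last by have := bv k; rewrite !inE eqxx.
    by apply/forallP => i; have := bv i; rewrite !inE; case: eqP.
  have := qv i; rewrite !inE; have [->|//] := eqVneq i k.
  by rewrite vk.
have -> : \sum_(v | in_box A v) (h (grid_up k v) + h v) =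
   \sum_(v | Q v && (v k != ord0)) h v + \sum_(v | Q v && (v k < K)%N) h v.
  rewrite big_split /=; congr (_ + _); last by apply: eq_bigl => v; exact: inboxE.
  rewrite [RHS](reindex_onto (grid_up k) down) /=.
    apply: eq_bigl => v; rewrite inboxE.
    have -> : Q (grid_up k v) = Q v.
      by apply: eq_forallb => i; rewrite ffunE; case: eqP.
    case: (Q v) => //=; apply/idP/andP => [vK|[]].
      have uvk : (grid_up k v k = (v k).+1 :> nat) by rewrite ffunE eqxx inordK.
      split; first by rewrite -val_eqE /= uvk.
      apply/eqP/ffunP => i; rewrite ffunE; have [->|ik] := eqVneq i k.
        by rewrite uvk /=; apply: val_inj; rewrite /= inordK// ltnW.
      by rewrite ffunE (negbTE ik).
    (* If [v k = K], then [inord] returns 0, which [uv0] excludes. *)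
    rewrite ltnNge => uv0 _; apply/negP => Kv.
    move: uv0; rewrite ffunE eqxx /inord /insubd insubF//=.
    by apply/negbTE; rewrite -leqNgt.
  move=> v /andP[_ vk0]; apply/ffunP => i; rewrite !ffunE.
  case: eqP => // ->; apply: val_inj => /=.
  have vk := ltn_ord (v k); have v0 : (0 < v k)%N by rewrite lt0n.
  have e : (inord (v k).-1 : 'I_K.+1) = (v k).-1 :> nat.
    by rewrite inordK// (leq_ltn_trans (leq_pred _)).
  by rewrite e prednK// inordK.
have tot : \sum_(v | Q v && (v k != ord0)) h v + \sum_(v | Q v && (v k == ord0)) h v
  = \sum_(v | Q v && (v k < K)%N) h v + \sum_(v | Q v && (v k == ord_max)) h v.
  rewrite addrC -(bigID (fun v => v k == ord0)) (bigID (fun v => (v k < K)%N) Q)/=.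
  congr (_ + _); apply: eq_bigl => v; rewrite -leqNgt -val_eqE/= eqn_leq.
  by rewrite leq_ord.
under [X in _ = X + _]eq_bigl do rewrite inbox'E.
have -> : \sum_(v | in_box A v && (v k == ord0)) h v =
  \sum_(v | Q v && (v k == ord0)) h v.
  apply: eq_bigl => v; rewrite inboxE -andbA.
  by case: (eqVneq (v k) ord0) => [->|]; rewrite ?andbF//= K_gt0.
by apply: F2_addr_eq0; rewrite [X in _ + X]addrC addrACA tot F2_addrr.
Qed.

Hypothesis c0 : forall k v, v k = ord0 -> c k v = 0.
Hypothesis c1 : forall k v, v k = ord_max -> c k v = 1.

(* By induction and Stokes: the cocycle is the coboundary of c_l \cup dc_(L),
   which only contributes on the face v_l = K. *)
Lemma sum_cup_delta L :
  uniq L -> \sum_(v | in_box [set x in L] v) cup_delta L [set x in L] v = 1.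
Proof.
elim: L => [_|l L IH /= /andP[lL uL]].
  rewrite (big_pred1 [ffun=> ord_max])// => v; apply/forallP/eqP => [bv|-> i].
    by apply/ffunP => i; rewrite ffunE; have := bv i; rewrite inE/= => /eqP.
  by rewrite inE/= ffunE.
have lS : l \in [set x in l :: L] by rewrite !inE eqxx.
have SDl : [set x in l :: L] :\ l = [set x in L].
  by apply/setP => x; rewrite !inE; case: eqP => //= ->; rewrite (negbTE lL).
rewrite (eq_bigr _ (fun v _ => cup_delta_cons l L _ v)) exchange_big/=.
rewrite (bigD1 l)//= [X in _ + X]big1 ?addr0 => [|k /andP[kL kl]].
  (* In direction [l] the lower end face vanishes by [c0]; the upper one, where [c l] is 1, gives
     the inductive sum. *)
  rewrite (@sum_in_box_up _ l (fun v => c l v * cup_delta L ([set x in l :: L] :\ l) v))//.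
  rewrite SDl [X in _ + X]big1 ?addr0 => [|v /andP[_ /eqP vl]]; last first.
    by rewrite c0 ?mul0r.
  rewrite -[RHS](IH uL); apply: eq_bigr => v /forallP/(_ l).
  by rewrite inE (negbTE lL) => /eqP vl; rewrite c1 ?mul1r.
(* In a direction [k != l] both end faces vanish, since dc_k occurs in the product and [c k] is
   constant on each of them. *)
have {}kL : k \in L by move: kL; rewrite !inE (negbTE kl).
rewrite (@sum_in_box_up _ k (fun v => c l v * cup_delta L ([set x in l :: L] :\ k) v));
  last by rewrite !inE kL orbT.
have kA : k \notin [set x in l :: L] :\ k by rewrite !inE eqxx.
rewrite !big1 ?addr0// => v.
  move=> /andP[_ /eqP vk]; rewrite (@cup_delta_face k ord0) ?mulr0// => w w' wk w'k.
  by rewrite !c0.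
move=> /forallP/(_ k); rewrite (negbTE kA) => /eqP vk.
rewrite (@cup_delta_face k ord_max) ?mulr0// => w w' wk w'k.
by rewrite !c1.
Qed.

(** A nonzero sum has a nonzero term: a monotone edge path on which each label of [L] changes along
    its own edge. *)
Lemma cup_delta_neq0 L A v l : cup_delta L A v != 0 -> l \in L ->
  exists w w' : grid, c l w != c l w' /\
   forall i, w i \in [:: v i; inord (v i).+1] /\ w' i \in [:: v i; inord (v i).+1].
Proof.
(* Recording that only directions in [A] move ensures, in the induction, that no coordinate is
   raised twice. *)
suff near : cup_delta L A v != 0 -> l \in L ->
  exists w w' : grid, c l w != c l w' /\ forall i,
   ((w i == v i) || (i \in A) && (w i == inord (v i).+1)) /\
   ((w' i == v i) || (i \in A) && (w' i == inord (v i).+1)).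
  move=> vn lL; have [w [w' [ww' H]]] := near vn lL.
  exists w, w'; split=> // i; have [] := H i; rewrite !inE.
  by case=> /orP[->|/andP[_ ->]] /orP[->|/andP[_ ->]]; rewrite ?orbT.
elim: L A v => // l' L IH A v /= sum_neq0 lL.
have [k kA] : exists2 k, k \in A &
    (c l' (grid_up k v) + c l' v) * cup_delta L (A :\ k) (grid_up k v) != 0.
  apply: contrapT => none; move/eqP: sum_neq0; apply; apply: big1 => k kA.
  by apply/eqP; apply: contrapT => /negP ?; apply: none; exists k.
rewrite mulf_eq0 negb_or => /andP[cneq cupneq].
have [ll'|ll'] := eqVneq l l'.
  exists (grid_up k v), v; split.
    by rewrite ll'; apply: contra cneq => /eqP ->; rewrite F2_addrr.
  move=> i; rewrite eqxx ffunE; split=> //.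
  by have [->|_] := eqVneq i k; rewrite ?eqxx ?kA ?orbT.
move: lL; rewrite in_cons (negbTE ll')/= => lL.
have [w [w' [ww' H]]] := IH _ _ cupneq lL.
exists w, w'; split=> // i; have := H i; rewrite !inE ffunE.
by have [->|_] := eqVneq i k; rewrite /= ?orbF ?kA//= => -[-> ->]; rewrite !orbT.
Qed.

End CubicalSperner.

Lemma cubical_sperner (m K : nat) (lab : 'I_m -> {ffun 'I_m -> 'I_K.+1} -> bool) :
  (0 < K)%N ->
  (forall k (v : {ffun 'I_m -> 'I_K.+1}), v k = ord0 -> lab k v = false) ->
  (forall k (v : {ffun 'I_m -> 'I_K.+1}), v k = ord_max -> lab k v = true) ->
  exists v : {ffun 'I_m -> 'I_K.+1}, forall k,
    exists w w' : {ffun 'I_m -> 'I_K.+1}, lab k w != lab k w' /\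
      forall i, (v i <= w i <= (v i).+1)%N /\ (v i <= w' i <= (v i).+1)%N.
Proof.
move=> K_gt0 lab0 lab1; pose c k (v : {ffun 'I_m -> 'I_K.+1}) : 'F_2 := (lab k v)%:R.
have c0 k (v : {ffun 'I_m -> 'I_K.+1}) : v k = ord0 -> c k v = 0 by move=> /lab0; rewrite /c => ->.
have c1 k (v : {ffun 'I_m -> 'I_K.+1}) : v k = ord_max -> c k v = 1 by move=> /lab1; rewrite /c => ->.
have := sum_cup_delta K_gt0 c0 c1 (enum_uniq 'I_m).
have -> : [set x in enum 'I_m] = finset.setT.
  by apply/setP => x; rewrite !inE mem_enum.
move=> sum1.
have [v vbox vn] : exists2 v, in_box finset.setT v & cup_delta c (enum 'I_m) finset.setT v != 0.
  apply: contrapT => none; suff: (0 : 'F_2) = 1 by [].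
  rewrite -sum1 big1// => v vbox.
  by apply/eqP; apply: contrapT => /negP ?; apply: none; exists v.
exists v => k; have [w [w' [cw H]]] := cup_delta_neq0 vn (mem_enum _ k).
exists w, w'; split; first by apply: contra cw; rewrite /c => /eqP ->.
(* In the full box all coordinates of [v] are below [K], so [inord] is the true successor. *)
move=> i; have := forallP vbox i; rewrite inE => vK; have [] := H i.
by rewrite !inE => /orP[]/eqP -> /orP[]/eqP ->; rewrite ?inordK ?leqnn ?leqnSn.
Qed.

(** * Angles between points of the circle *)

Section Angles.
Variable R : realType.
Implicit Types (p q : R * R) (t x y : R).

Definition on_circle p := p.1 ^+ 2 + p.2 ^+ 2 = 1.
(** In complex notation [dot p q] and [det p q] are the real and imaginary parts of the conjugate of
    [p] times [q]. *)
Definition dot p q := p.1 * q.1 + p.2 * q.2.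
Definition det p q := p.1 * q.2 - p.2 * q.1.
Definition cis t : R * R := (cos t, sin t).
Definition rot p t : R * R :=
  (p.1 * cos t - p.2 * sin t, p.1 * sin t + p.2 * cos t).
(** This is the signed angle from [p] to [q] only when [dot p q > 0], but it is bounded by pi/2 for
    all points of the circle. *)
Definition angle p q : R := asin (det p q).

Lemma on_circle_cis t : on_circle (cis t).
Proof. exact: cos2Dsin2. Qed.

Lemma rotD p x y : rot (rot p x) y = rot p (x + y).
Proof. by rewrite /rot /= cosD sinD; congr pair; ring. Qed.

Lemma rot0 p : rot p 0 = p.
Proof. by case: p => a b; rewrite /rot /= cos0 sin0 !mulr1 !mulr0 subr0 add0r. Qed.

Lemma rot_cis x y : rot (cis x) y = cis (x + y).
Proof. by rewrite /rot /cis /= cosD sinD; congr pair; ring. Qed.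

Lemma dot_rot p x y : on_circle p -> dot (rot p x) (rot p y) = cos (x - y).
Proof. by rewrite /on_circle /dot /rot cosB => p1 /=; rewrite -[RHS]mul1r -p1; ring. Qed.

Lemma dot2Ddet2 p q : on_circle p -> on_circle q ->
  dot p q ^+ 2 + det p q ^+ 2 = 1.
Proof.
rewrite /on_circle => p1 q1.
have -> : dot p q ^+ 2 + det p q ^+ 2 =
  (p.1 ^+ 2 + p.2 ^+ 2) * (q.1 ^+ 2 + q.2 ^+ 2) by rewrite /dot /det; ring.
by rewrite p1 q1 mulr1.
Qed.

Lemma det_itv p q : on_circle p -> on_circle q -> -1 <= det p q <= 1.
Proof.
move=> p1 q1; have := dot2Ddet2 p1 q1; have := sqr_ge0 (dot p q).
by rewrite -ler_norml -[_ <= 1](@ler_pXn2r _ 2%N) ?nnegrE// expr1n real_normK ?num_real//; lra.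
Qed.
Lemma normr_angle p q : on_circle p -> on_circle q -> `|angle p q| <= pi / 2.
Proof.
move=> p1 q1; have d := det_itv p1 q1.
by rewrite ler_norml asin_geNpi2// asin_lepi2.
Qed.

Lemma cos_angle p q : on_circle p -> on_circle q -> 0 < dot p q ->
  cos (angle p q) = dot p q.
Proof.
move=> p1 q1 pq; rewrite cos_asin ?det_itv// -(dot2Ddet2 p1 q1) addrK.
by rewrite sqrtr_sqr gtr0_norm.
Qed.

Lemma sin_angle p q : on_circle p -> on_circle q -> sin (angle p q) = det p q.
Proof. by move=> p1 q1; rewrite asinK// in_itv/= det_itv. Qed.

Lemma rot_angle p q : on_circle p -> on_circle q -> 0 < dot p q ->
  rot p (angle p q) = q.
Proof.
move=> p1 q1 pq; rewrite /rot cos_angle// sin_angle//.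
rewrite [RHS]surjective_pairing -[q.1 in RHS]mul1r -[q.2 in RHS]mul1r -p1.
by rewrite /dot /det; congr pair; ring.
Qed.

Lemma normr_angle_lt p q : on_circle p -> on_circle q -> 0 < dot p q ->
  `|angle p q| < pi / 2.
Proof.
move=> p1 q1 pq; rewrite lt_neqAle normr_angle// andbT.
apply/eqP => apq.
by move: (pq); rewrite -cos_angle// -cos_norm apq cos_pihalf ltxx.
Qed.

Lemma cos_gt0_normr_lt y : `|y| < pi / 2 + pi -> 0 < cos y -> `|y| < pi / 2.
Proof.
rewrite -cos_norm => yb; apply: contraTT; rewrite -!leNgt => yge.
rewrite -[X in cos X](subrK pi) cosDpi oppr_le0 cos_ge0_pihalf//.
by have := @pi_gt0 R; lra.
Qed.

Lemma cos_eq1_normr y : `|y| < pi *+ 2 -> cos y = 1 -> y = 0.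
Proof.
move=> yb cy1; apply/eqP; rewrite -normr_le0 leNgt; apply/negP => y0.
have : 0 < sin (`|y| / 2) by apply: sin_gt0_pi; lra.
suff : sin (`|y| / 2) ^+ 2 = 0 by move/eqP; rewrite sqrf_eq0 => /eqP ->; rewrite ltxx.
have e : (`|y| / 2) *+ 2 = `|y| by rewrite -mulr_natr divfK.
by have := cos_mulr2n (`|y| / 2); rewrite e cos_norm cy1 sin2cos2; lra.
Qed.

(** Discrete analogue of the total change of argument along a path. *)
Definition lift_angle (p : nat -> R * R) (N : nat) : R :=
  \sum_(j < N) angle (p j) (p j.+1).

Lemma normr_lift_angle (p : nat -> R * R) (N : nat) :
  (forall j, on_circle (p j)) -> `|lift_angle p N| <= N%:R * (pi / 2).
Proof.
move=> p1; apply: le_trans (ler_norm_sum _ _ _) _.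
rewrite mulr_natl -[X in _ <= _ *+ X]card_ord -sumr_const.
by apply: ler_sum => j _; exact: normr_angle.
Qed.

Lemma rot_lift_angle (p : nat -> R * R) (N : nat) :
  (forall j, on_circle (p j)) ->
  (forall j, (j < N)%N -> 0 < dot (p j) (p j.+1)) ->
  rot (p 0%N) (lift_angle p N) = p N.
Proof.
move=> p1; rewrite /lift_angle; elim: N => [|N IH] pp; first by rewrite big_ord0 rot0.
by rewrite big_ord_recr/= -rotD IH ?rot_angle// ?pp// => j jN; apply: pp; exact: ltnW.
Qed.

(** Each step changes the difference of the lifts by less than pi, so it stays below 3pi/2; its
    cosine is the positive [dot] of the new end points, which brings it back below pi/2. *)
Lemma lift_angle_close (p q : nat -> R * R) (N : nat) :
  (forall j, on_circle (p j)) -> (forall j, on_circle (q j)) -> p 0%N = q 0%N ->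
  (forall j, (j < N)%N -> 0 < dot (p j) (p j.+1)) ->
  (forall j, (j < N)%N -> 0 < dot (q j) (q j.+1)) ->
  (forall j, (j <= N)%N -> 0 < dot (p j) (q j)) ->
  `|lift_angle p N - lift_angle q N| < pi / 2.
Proof.
move=> p1 q1 pq0; elim: N => [|N IH] pp qq pq.
  by rewrite /lift_angle !big_ord0 subrr normr0 divr_gt0 ?pi_gt0.
have {IH}IH : `|lift_angle p N - lift_angle q N| < pi / 2.
  apply: IH => j jN; [apply: pp | apply: qq | apply: pq];
  by [exact: ltnW | exact: leqW].
apply: cos_gt0_normr_lt; last first.
  by rewrite -(dot_rot _ _ (p1 0%N)) [in rot _ (lift_angle q _)]pq0 !rot_lift_angle// pq.
rewrite /lift_angle !big_ord_recr /= -!/(lift_angle _ _).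
have := normr_angle_lt (p1 N) (p1 N.+1) (pp N (ltnSn N)).
have := normr_angle_lt (q1 N) (q1 N.+1) (qq N (ltnSn N)).
move: IH; rewrite /lift_angle !ltr_norml.
lra.
Qed.

(** Both sides are arguments of the common starting point, and they differ by less than 1 + pi/2,
    hence by less than 2pi. *)
Lemma lift_angle_eq (p q : nat -> R * R) (N : nat) x y :
  (forall j, on_circle (p j)) -> (forall j, on_circle (q j)) -> p 0%N = q 0%N ->
  (forall j, (j < N)%N -> 0 < dot (p j) (p j.+1)) ->
  (forall j, (j < N)%N -> 0 < dot (q j) (q j.+1)) ->
  (forall j, (j <= N)%N -> 0 < dot (p j) (q j)) ->
  p N = cis x -> q N = cis y -> `|x - y| < 1 ->
  x - lift_angle p N = y - lift_angle q N.
Proof.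
move=> p1 q1 pq0 pp qq pq pN qN xy.
have close := lift_angle_close p1 q1 pq0 pp qq pq.
have back (r : nat -> R * R) z : (forall j, on_circle (r j)) ->
    (forall j, (j < N)%N -> 0 < dot (r j) (r j.+1)) -> r N = cis z ->
    r 0%N = cis (z - lift_angle r N).
  move=> r1 rr rN; rewrite -rot_cis -rN -(rot_lift_angle r1 rr) rotD.
  by rewrite addrN rot0.
apply/eqP; rewrite -subr_eq0; apply/eqP; apply: cos_eq1_normr.
  have := @pi_ge2 R; move: xy close; rewrite !ltr_norml; lra.
have := back _ _ p1 pp pN; rewrite pq0 (back _ _ q1 qq qN) => -[c s].
rewrite cosB c s; have := cos2Dsin2 (x - lift_angle p N).
by rewrite !expr2.
Qed.

End Angles.

(** * Null-homotopic coordinates on an open cover of the torus *)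

Definition close_rV (R : realType) (m : nat) (e : R) (x y : 'rV[R]_m) :=
  forall i, `|x 0 i - y 0 i| < e.

Lemma no_uniform_contraction (R : realType) (m : nat)
    (H : 'I_m -> 'rV[R]_m -> R -> R * R) (c : 'I_m -> R * R) (e : R) :
  0 < e -> e <= 2^-1 ->
  (forall l x t, on_circle (H l x t)) ->
  ~ (forall x, exists l, forall y z, close_rV e x y -> close_rV e x z ->
      [/\ H l y 0 = c l, H l y 1 = cis (y 0 l) &
          forall t t', 0 <= t <= 1 -> 0 <= t' <= 1 -> `|t - t'| < e ->
            0 < dot (H l y t) (H l z t')]).
Proof.
move=> e_gt0 e_le Hcircle Hunif.
pose N := (Num.truncn e^-1).+1.
have N_gt0 : 0 < N%:R :> R by rewrite ltr0n.
have Ne : N%:R^-1 < e.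
  by rewrite -[ltRHS]invrK ltf_pV2 ?posrE ?invr_gt0// truncnS_gt.
pose P l x (j : nat) := H l x (j%:R / N%:R).
(* [G l] is the coordinate [x 0 l] minus the logarithm obtained by following the homotopy [H l x] in
   [N] time steps shorter than [e]. *)
pose G l (x : 'rV[R]_m) := x 0 l - lift_angle (P l x) N.
have Pc l x j : on_circle (P l x j) by exact: Hcircle.
(* [M] exceeds the bound on the lifts by 1, so [G l] is negative at [x 0 l = - M] and positive at
   [x 0 l = M]. *)
pose M : R := N%:R * (pi / 2) + 1.
have M_gt0 : 0 < M by rewrite addr_gt0// !mulr_gt0 ?invr_gt0 ?pi_gt0.
(* With [K] steps per side, the grid on [-M, M]^m has mesh less than [e]. *)
pose K := (Num.truncn (2 * M / e)).+1.
have K_gt0 : 0 < K%:R :> R by rewrite ltr0n.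
have Ke : 2 * M / K%:R < e.
  by rewrite ltr_pdivrMr// [e * _]mulrC -ltr_pdivrMr// truncnS_gt.
pose X (v : {ffun 'I_m -> 'I_K.+1}) : 'rV[R]_m := \row_i (2 * M / K%:R * (v i)%:R - M).
pose lab l v := 0 < G l (X v).
have [] := @cubical_sperner m K lab isT.
- move=> l v vl; apply/negbTE; rewrite -leNgt /G mxE vl mulr0 sub0r.
  have := normr_lift_angle N (Pc l (X v)).
  by rewrite ler_norml /M; lra.
- move=> l v vl; rewrite /lab /G mxE vl divfK ?gt_eqF//.
  have := normr_lift_angle N (Pc l (X v)).
  by rewrite ler_norml /M; lra.
move=> v cell; have [l Hl] := Hunif (X v).
have [w [w' [ww' vww']]] := cell l.
have near (u : {ffun 'I_m -> 'I_K.+1}) :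
    (forall i, (v i <= u i <= (v i).+1)%N) -> close_rV e (X v) (X u).
  move=> vu i; rewrite !mxE distrC [X in `|X|](_ : _ = 2 * M / K%:R * ((u i)%:R - (v i)%:R)); last by ring.
  rewrite normrM gtr0_norm; last by rewrite divr_gt0// mulr_gt0.
  apply: le_lt_trans Ke; rewrite ler_piMr//; first by rewrite divr_ge0// mulr_ge0// ltW.
  have /andP[vu1 vu2] := vu i; rewrite -natrB//.
  by rewrite normr_nat lern1 leq_subLR addn1.
have nw : close_rV e (X v) (X w) by apply: near => i; exact: (vww' i).1.
have nw' : close_rV e (X v) (X w') by apply: near => i; exact: (vww' i).2.
suff GG : G l (X w) = G l (X w') by move: ww'; rewrite /lab GG eqxx.
have [Hw0 Hw1 Hww] := Hl _ _ nw nw.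
have [Hw'0 Hw'1 Hw'w'] := Hl _ _ nw' nw'.
have [_ _ Hww'] := Hl _ _ nw nw'.
have itv j : (j <= N)%N -> 0 <= (j%:R / N%:R : R) <= 1.
  by move=> jN; rewrite divr_ge0//= ler_pdivrMr// mul1r ler_nat.
have step j : `|j%:R / N%:R - j.+1%:R / N%:R| < e :> R.
  by rewrite -mulrBl -natr1 opprD addNKr normrM normrN1 mul1r gtr0_norm ?invr_gt0.
apply: lift_angle_eq => //.
- by rewrite /P mul0r Hw0 Hw'0.
- by move=> j jN; apply: Hww => //; apply: itv => //; exact: ltnW.
- by move=> j jN; apply: Hw'w' => //; apply: itv => //; exact: ltnW.
- by move=> j jN; apply: Hww'; rewrite ?itv// subrr normr0.
- by rewrite /P divff ?gt_eqF.
- by rewrite /P divff ?gt_eqF.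
(* Both points are within [e <= 1/2] of [X v], so their coordinates differ by less than 1. *)
have := nw l; have := nw' l; rewrite !ltr_norml; lra.
Qed.

Lemma continuous_ptws (I : eqType) (T X : topologicalType) (f : T -> {ptws I -> X}) :
  (forall i, continuous (fun x => f x i)) -> continuous f.
Proof.
move=> cf x; apply/cvg_sup => i; move: x.
apply/(@continuousP _ (initial_topology (@^~ i))) => A [B oB <-].
by move/continuousP : (cf i) => /(_ _ oB).
Qed.

(** Write q = p + a and r = p + b with entries of a, b below 1/8: the dot product is at least 1 -
    1/2 - 1/32. *)
Lemma dot_gt0_near (R : realType) (p q r : R * R) : on_circle p ->
  ball p 8^-1 q -> ball p 8^-1 r -> 0 < dot q r.
Proof.
case: p q r => [p1 p2] [q1 q2] [r1 r2]; rewrite /on_circle /= => p_1.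
move=> [/= a b] [/= c d]; move: a b c d; rewrite /ball/= /ball_ /dot/= !ltr_norml.
move=> /andP[a1 a2] /andP[b1 b2] /andP[c1 c2] /andP[d1 d2].
have p1b : -1 <= p1 <= 1 by nra.
have p2b : -1 <= p2 <= 1 by nra.
nra.
Qed.

Lemma cis_shift (R : realType) (t : R) :
  exists2 d, cis d = (1, 0) & 0 <= t + d <= pi *+ 2.
Proof.
have nat_shift (k : nat) : cis ((pi *+ 2) *+ k) = (1, 0) :> R * R.
  rewrite /cis -[_ *+ k]add0r (periodicn (@cosD2pi R)) (periodicn (@sinD2pi R)).
  by rewrite cos0 sin0.
have pi2 : 0 < pi *+ 2 :> R by rewrite mulrn_wgt0// pi_gt0.
pose z := Num.floor (t / (pi *+ 2)).
have /andP[z1 z2] : z%:~R <= t / (pi *+ 2) < (z + 1)%:~R by exact: floor_itv.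
exists (- (z%:~R * (pi *+ 2))); last first.
  move: z1 z2; rewrite ler_pdivlMr// ltr_pdivrMr// intrD mulrDl mul1r.
  lra.
case: (z) => k.
  have -> : k%:~R * (pi *+ 2) = (pi *+ 2) *+ k :> R by rewrite -[RHS]mulr_natl -[k%:R]pmulrn.
  by have [c s] := nat_shift k; rewrite /cis cosN sinN c s oppr0.
have -> : - ((Negz k)%:~R * (pi *+ 2)) = (pi *+ 2) *+ k.+1 :> R.
  by rewrite NegzE mulrNz mulNr opprK -[RHS]mulr_natl -[k.+1%:R]pmulrn.
exact: nat_shift.
Qed.

(** * A uniform radius from compactness and periodicity *)

Section Uniform.
Variables (R : realType) (m : nat).
Variables (U : 'I_m -> set 'rV[R]_m) (H : 'I_m -> 'rV[R]_m -> R -> R * R).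
Hypothesis Hcircle : forall l x t, on_circle (H l x t).
Hypothesis Uopen : forall l, open (U l).
Hypothesis Hcont : forall l x t, U l x ->
  {for (x, t), continuous (fun z => H l z.1 z.2)}.

Definition contracted (e : R) (l : 'I_m) (x : 'rV[R]_m) (t : R) :=
  forall y z, close_rV e x y -> close_rV e x z ->
    U l y /\ forall t', `|t - t'| < e -> 0 < dot (H l y t) (H l z t').

Lemma contracted_locally l x t : U l x ->
  exists2 e, 0 < e & forall d y s, 0 < d <= e -> close_rV e x y -> `|t - s| < e ->
    contracted d l y s.
Proof.
move=> Ux.
have near_xt : \forall z \near (x, t), U l z.1 /\ ball (H l x t) 8^-1 (H l z.1 z.2).
  have e8 : 0 < 8^-1 :> R by rewrite invr_gt0.
  have := @Hcont l x t Ux _ (nbhsx_ballx (H l x t) _ e8).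
  move=> near_ball.
  apply: filterI; last exact: near_ball.
  by apply: (@cvg_fst _ _ (nbhs x) (nbhs t)); exact: open_nbhs_nbhs.
have /nbhs_ballP[e /= e_gt0 eP] := near_xt.
have near_e y s : close_rV e x y -> `|t - s| < e ->
    U l y /\ ball (H l x t) 8^-1 (H l y s).
  move=> xy ts; apply: (eP (y, s)); split=> //=; split=> // i k.
  by rewrite ord1 /ball/= /ball_; exact: xy.
(* Halving leaves room for a second displacement, from [y] to [y1] or [y2] and from [s] to [t']. *)
exists (e / 2 : R); first by rewrite divr_gt0.
move=> d y s /andP[d_gt0 de] xy ts y1 y2 yy1 yy2.
have tri1 (a b c : R) : `|a - b| < e / 2 -> `|b - c| < d -> `|a - c| < e :> R.
  by rewrite !ltr_norml; lra.
have xy1 : close_rV e x y1 by move=> i; exact: tri1 (xy i) (yy1 i).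
have xy2 : close_rV e x y2 by move=> i; exact: tri1 (xy i) (yy2 i).
have tse : `|t - s| < e by move: ts; rewrite !ltr_norml; lra.
split=> [|t' st']; first exact: (near_e _ _ xy1 tse).1.
apply: (dot_gt0_near (Hcircle l x t)); first exact: (near_e _ _ xy1 tse).2.
by apply: (near_e _ _ xy2 _).2; exact: tri1 ts st'.
Qed.

(** Tube lemma: compactness of [0, 1] gives one radius for all times. *)
Lemma contracted_near l x : U l x ->
  exists2 e, 0 < e & forall d y t, 0 < d <= e -> close_rV e x y -> 0 <= t <= 1 ->
    contracted d l y t.
Proof.
move=> Ux.
pose P (d : R) (s : R) := forall d' y, 0 < d' <= d -> close_rV d x y -> contracted d' l y s.
have /compact_near_coveringP cov := @segment_compact R 0 1.
have Pd : \forall d \near 0^'+, `[0, 1]%classic `<=` P d.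
  apply: cov => s _.
  have [e e_gt0 eP] := contracted_locally s Ux.
  exists (ball s e, [set d | 0 < d < e]) => /=.
    split; first exact: nbhsx_ballx.
    by near=> d; apply/andP; split=> //; near: d; exact: nbhs_right_lt.
  move=> [s' d] /= [ss' /andP[d0 de]] d' y /andP[d'0 d'd] xy.
  apply: eP => //; first by rewrite d'0 (le_trans d'd)// ltW.
  by move=> i; exact: lt_trans (xy i) de.
have /filter_ex[e [e_gt0 Pe]] : \forall d \near 0^'+, 0 < d /\ `[0, 1]%classic `<=` P d.
  by apply: filterI Pd; exact: nbhs_right_gt.
by exists e => // d y t de xy t01; apply: Pe => //=; rewrite in_itv.
Unshelve. all: by end_near. Qed.

Hypothesis Ucover : forall x, exists l, U l x.
Hypothesis Uperiodic : forall l (x y : 'rV[R]_m), (forall i, cis (x 0 i) = cis (y 0 i)) ->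
  U l x -> U l y.
Hypothesis Hperiodic : forall l (x y : 'rV[R]_m) t, (forall i, cis (x 0 i) = cis (y 0 i)) ->
  H l x t = H l y t.

(** A Lebesgue number argument on the compact cube [0, 2pi]^m, extended to all of R^m by translating
    by multiples of 2pi. *)
Lemma uniformly_contracted : exists2 e, 0 < e <= 2^-1 &
  forall x, exists l, forall t, 0 <= t <= 1 -> contracted e l x t.
Proof.
pose Q (d : R) (x : 'rV[R]_m) := exists l, forall t, 0 <= t <= 1 -> contracted d l x t.
have /compact_near_coveringP cov :=
  @rV_compact R m _ (fun _ => @segment_compact R 0 (pi *+ 2)).
have Qd : \forall d \near 0^'+,
    [set v : 'rV[R]_m | forall i, `[0, pi *+ 2]%classic (v ord0 i)] `<=` Q d.
  apply: cov => x _; have [l Ux] := Ucover x; have [e e_gt0 eP] := contracted_near Ux.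
  exists (ball x e, [set d | 0 < d < e]) => /=.
    split; first exact: nbhsx_ballx.
    by near=> d; apply/andP; split=> //; near: d; exact: nbhs_right_lt.
  move=> [y d] /= [[_ xy] /andP[d0 de]]; exists l => t t01.
  by apply: eP => //; [rewrite d0 ltW | move=> i; exact: xy].
have /filter_ex[e [e_gt0 [e_lt Qe]]] : \forall d \near 0^'+, 0 < d /\ (d < 2^-1 /\
    [set v : 'rV[R]_m | forall i, `[0, pi *+ 2]%classic (v ord0 i)] `<=` Q d).
  apply: filterI; first exact: nbhs_right_gt.
  by apply: filterI Qd; apply: nbhs_right_lt; rewrite invr_gt0.
exists e; first by rewrite e_gt0 ltW.
move=> x; have /choice[d dP] : forall i, exists d, cis d = (1, 0) /\ 0 <= x 0 i + d <= pi *+ 2.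
  by move=> i; have [d] := cis_shift (x 0 i); exists d.
pose D : 'rV[R]_m := \row_i d i.
have cisD (z : 'rV[R]_m) i : cis ((z + D) 0 i) = cis (z 0 i).
  have [/= c s] := (dP i).1; rewrite /cis !mxE cosD sinD c s.
  by rewrite !mulr1 !mulr0 subr0 addr0.
have [i|l lP] := Qe (x + D); first by rewrite /= in_itv/= !mxE; exact: (dP i).2.
exists l => t t01 y z xy xz.
have shift (w : 'rV[R]_m) : close_rV e x w -> close_rV e (x + D) (w + D).
  by move=> xw i; rewrite !mxE opprD addrACA subrr addr0; exact: xw.
have [Uy yz] := lP t t01 _ _ (shift _ xy) (shift _ xz).
split; first by apply: (Uperiodic _ Uy) => i; exact: cisD.
move=> t' tt'; have := yz t' tt'.
by rewrite !(@Hperiodic l (_ + D) _ _ (cisD _)).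
Unshelve. all: by end_near. Qed.

End Uniform.

(** * The torus in the anchored configuration space *)

Lemma nbhs_set_typeE (X : topologicalType) (A : set X) (x : set_type A)
    (N : set (set_type A)) :
  nbhs x N -> exists2 B, nbhs (set_val x) B & set_val @^-1` B `<=` N.
Proof.
move=> [_ /= [] [B oB <-] /= Bx BN]; exists B => //.
exact: open_nbhs_nbhs.
Qed.

Lemma compact_set_type (X : topologicalType) (A : set X) :
  compact A -> compact [set: set_type A].
Proof.
move=> cA F FF _.
have FA : (set_val @ F) A.
  have -> : (set_val @ F) A = F setT; last exact: filterT.
  by congr F; apply/seteqP; split=> // -[x Ax] _; exact: set_mem Ax.
have [x [Ax clx]] := cA (set_val @ F) _ FA.
exists (exist _ x (mem_set Ax)); split=> // P N FP /nbhs_set_typeE[B Bx BN].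
have FP' : (set_val @ F) (set_val @` P).
  by apply: (@filterS _ F _ P) FP => y Py; exists y.
have [_ [[y Py <-] By]] := clx _ _ FP' Bx.
by exists y; split=> //; exact: BN.
Qed.

Lemma compact_unit_interval (R : realType) : compact [set: unit_interval R].
Proof. by apply: compact_set_type; exact: segment_compact. Qed.

Lemma regular_unit_interval (R : realType) : regular_space (unit_interval R).
Proof. exact: (@uniform_regular (set_type (`[0, 1] : set R))). Qed.

Lemma continuous_set_type (X Y : topologicalType) (A : set X) (f : Y -> set_type A) :
  continuous (fun y => set_val (f y)) -> continuous f.
Proof. exact: continuous_comp_initial. Qed.

Section Eval.
Import ArrowAsCompactOpen.

(** Evaluation is continuous for the compact-open topology because the interval is locally compact
    and regular; this turns a local section into a homotopy. *)
Lemma path_space_eval_continuous (R : realType) (X : topologicalType) :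
  continuous (fun z : path_space R X * unit_interval R =>
    (z.1 : continuousType (unit_interval R) X) z.2).
Proof.
have lc : locally_compact [set: unit_interval R].
  move=> x _; exists setT; first by rewrite withinET; exact: filterT.
  by split; [exact: compact_unit_interval | exact: closedT].
rewrite (_ : (fun z => _) = @eval (unit_interval R) X).
  exact: (eval_continuous lc (@regular_unit_interval R)).
by apply/funext => -[].
Qed.
End Eval.

(** * Coordinates of the paths chosen by a local section *)

Section LocalSection.
Variables (R : realType) (n s : nat) (S : set (circle R)).
Notation X := (anchored_config n S).

Definition config_point (p : X) (i : 'I_n) : R * R := set_val (set_val p i).

Lemma config_point_continuous (i : 'I_n) : continuous (config_point ^~ i).
Proof.
move=> p; apply: (@continuous_comp _ _ _ (fun p : X => set_val p i) set_val).
  apply: (@continuous_comp _ _ _ set_val (fun f : {ptws 'I_n -> circle R} => f i)).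
    exact: initial_continuous.
  exact: proj_continuous.
exact: initial_continuous.
Qed.

Lemma on_circle_config_point (p : X) (i : 'I_n) : on_circle (config_point p i).
Proof. exact: (set_valP (set_val p i)). Qed.

(* (1, 0) is a junk value outside of U. *)
Definition section_path (U : set {ptws 'I_s -> X})
    (sigma : set_type U -> path_space R X) (p : {ptws 'I_s -> X}) (i : 'I_n)
    (t : unit_interval R) : R * R :=
  if pselect (U p) is left Up then
    config_point ((sigma (exist _ p (mem_set Up)) : continuousType _ _) t) i
  else (1, 0).

Lemma on_circle_section_path U sigma p i t :
  on_circle (@section_path U sigma p i t).
Proof.
rewrite /section_path; case: pselect => [Up|_]; first exact: on_circle_config_point.
by rewrite /on_circle/= expr1n expr0n addr0.
Qed.

Lemma section_path_continuous U sigma i p t : open U -> continuous sigma -> U p ->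
  {for (p, t), continuous (fun z => @section_path U sigma z.1 i z.2)}.
Proof.
move=> oU csigma Up B.
rewrite /= {1}/section_path; case: pselect => // Up' nB.
pose u : set_type U := exist _ p (mem_set Up').
pose f (z : set_type U * unit_interval R) :=
  config_point ((sigma z.1 : continuousType _ _) z.2) i.
have cf : continuous f.
  move=> z; apply: (@continuous_comp _ _ _
     (fun z : set_type U * unit_interval R => (sigma z.1 : continuousType _ _) z.2)
     (config_point ^~ i)); last exact: config_point_continuous.
  apply: (@continuous_comp _ _ _
     (fun z : set_type U * unit_interval R => (sigma z.1, z.2))
     (fun z : path_space R X * unit_interval R =>
    (z.1 : continuousType (unit_interval R) X) z.2)); last exact: path_space_eval_continuous.
  case: z => v t'.
  have h1 : sigma z.1 @[z --> (v, t')] --> sigma v.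
    by apply: (@cvg_comp _ _ _ fst sigma _ (nbhs v)); [exact: cvg_fst | exact: csigma].
  have h2 : z.2 @[z --> (v, t')] --> t' by exact: cvg_snd.
  exact: (cvg_pair h1 h2).
have [[N T] /= [/nbhs_set_typeE[N' N'p N'N] nT] NTB] := cf (u, t) B nB.
exists (N' `&` U, T); first by split=> //=; apply: filterI => //; exact: open_nbhs_nbhs.
move=> [q t'] /= [[N'q Uq] Tt'].
rewrite /section_path; case: pselect => // Uq'.
by apply: (NTB (exist _ q (mem_set Uq'), t')); split=> //=; exact: N'N.
Qed.

End LocalSection.

(** * Reparametrised time and angular coordinates *)

Section Clamp.
Variable R : realType.

(** Retracting the line onto [0, 1] lets homotopies be defined for every real time. *)
Definition clamp (t : R) : R := Num.min 1 (Num.max 0 t).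

Lemma clamp_itv t : clamp t \in (`[0, 1]%classic : set R).
Proof.
apply: mem_set; rewrite /= in_itv/= /clamp.
by rewrite ge_min lexx le_min ler01 le_max lexx.
Qed.

Lemma clamp_continuous : continuous clamp.
Proof.
move=> t; apply: (@continuous_min R R (fun=> 1) ((fun=> 0) \max id)).
  exact: cvg_cst.
by apply: (@continuous_max R R (fun=> 0) id); [exact: cvg_cst | exact: cvg_id].
Qed.

Lemma clamp_id (t : R) : 0 <= t <= 1 -> clamp t = t.
Proof. by move=> /andP[t0 t1]; rewrite /clamp max_r// min_r. Qed.

Definition time_segment (t0 t1 : unit_interval R) (t : R) : unit_interval R :=
  exist _ (clamp (set_val t0 + (set_val t1 - set_val t0) * t)) (clamp_itv _).

Lemma unit_interval_itv (t : unit_interval R) : 0 <= set_val t <= 1.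
Proof. by have := set_valP t; rewrite /= in_itv. Qed.

Lemma time_segment0 t0 t1 : time_segment t0 t1 0 = t0.
Proof.
by apply: val_inj => /=; rewrite mulr0 addr0 clamp_id// unit_interval_itv.
Qed.

Lemma time_segment1 t0 t1 : time_segment t0 t1 1 = t1.
Proof.
by apply: val_inj => /=; rewrite mulr1 addrC subrK clamp_id// unit_interval_itv.
Qed.

Lemma time_segment_continuous t0 t1 : continuous (time_segment t0 t1).
Proof.
apply: (@continuous_set_type R R _ (time_segment t0 t1)) => t /=.
apply: (@continuous_comp _ _ _
  (fun t => set_val t0 + (set_val t1 - set_val t0) * t) clamp).
  by apply: cvgD; [exact: cvg_cst | apply: cvgM; [exact: cvg_cst | exact: cvg_id]].
exact: clamp_continuous.
Qed.

Lemma cis_continuous : continuous (@cis R).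
Proof.
move=> t; have h1 : cos t @[t --> t] --> cos t by exact: continuous_cos.
have h2 : sin t @[t --> t] --> sin t by exact: continuous_sin.
exact: (cvg_pair h1 h2).
Qed.

Definition circle_of (t : R) : circle R := exist _ (cis t) (mem_set (on_circle_cis t)).

Lemma circle_of_continuous : continuous circle_of.
Proof. by apply: (@continuous_set_type _ _ _ circle_of); exact: cis_continuous. Qed.

End Clamp.

(** * From a motion planner to contractions on the torus *)

Section Planner.
Variables (R : realType) (n s m : nat) (S : set (circle R)).
Notation X := (anchored_config n S).
Variables (pos : 'I_m -> 'I_s * 'I_n) (home : 'I_n -> 'I_s).
Variable base : 'I_s -> 'I_n -> circle R.
Hypothesis pos_inj : injective pos.
Hypothesis pos_home : forall i l, pos l <> (home i, i).
Hypothesis base_anchored : forall k c, S c ->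
  exists i, base k i = c /\ forall l, pos l <> (k, i).

Definition torus_coord (x : 'rV[R]_m) (k : 'I_s) : {ptws 'I_n -> circle R} :=
  fun i => if [pick l | pos l == (k, i)] is Some l then circle_of (x 0 l)
           else base k i.

Lemma torus_coord_pos x l : torus_coord x (pos l).1 (pos l).2 = circle_of (x 0 l).
Proof.
rewrite /torus_coord; case: pickP => [l' /eqP|/(_ l)]; last first.
  by rewrite -surjective_pairing eqxx.
by rewrite -surjective_pairing => /pos_inj ->.
Qed.

Lemma torus_coord_base x k i : (forall l, pos l <> (k, i)) ->
  torus_coord x k i = base k i.
Proof. by move=> ki; rewrite /torus_coord; case: pickP => // l /eqP /ki. Qed.

(** Both anchors are occupied by frozen coordinates, whatever the angles [x]. *)
Lemma torus_coord_anchored x k :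
  torus_coord x k \in [set p : {ptws 'I_n -> circle R} | S `<=` range p].
Proof.
apply: mem_set => c /(base_anchored k)[i [<- ki]].
by exists i => //; rewrite torus_coord_base.
Qed.

Definition torus (x : 'rV[R]_m) : {ptws 'I_s -> X} :=
  fun k => exist _ (torus_coord x k) (torus_coord_anchored x k).

Lemma torus_continuous : continuous torus.
Proof.
apply: continuous_ptws => k.
apply: (@continuous_set_type _ _ _ (fun x => torus x k)) => /=.
apply: continuous_ptws => i; rewrite -/(continuous (fun x => torus_coord x k i)).
rewrite /torus_coord; case: [pick l | pos l == (k, i)] => [l|] x.
  apply: (@continuous_comp _ _ _ (fun x : 'rV[R]_m => x 0 l) (@circle_of R)).
    exact: coord_continuous.
  exact: circle_of_continuous.
exact: (@cst_continuous _ _ (base k i) x).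
Qed.

Lemma torus_periodic (x y : 'rV[R]_m) :
  (forall l, cis (x 0 l) = cis (y 0 l)) -> torus x = torus y.
Proof.
move=> xy; apply/funext => k; apply: val_inj => /=; apply/funext => i.
by rewrite /torus_coord; case: pickP => // l _; apply: val_inj => /=.
Qed.

Lemma no_torus_planner (U : 'I_m -> set {ptws 'I_s -> X}) :
  (forall l, open (U l)) -> \bigcup_(l in [set: 'I_m]) U l = setT ->
  ~ (forall l, has_local_section R (U l)).
Proof.
move=> oU cU sU.
pose sigma l := projT1 (cid (sU l)).
have csigma l : continuous (sigma l) by have [] := projT2 (cid (sU l)).
have sigmaE l x : path_eval s (sigma l x) = set_val x.
  by have [_] := projT2 (cid (sU l)); exact.
(* The path given by [sigma l] is followed from the stop where coordinate [(pos l).2] is frozen to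
   the stop where it equals [cis (x 0 l)]. *)
pose time l := time_segment (stop_time R (home (pos l).2)) (stop_time R (pos l).1).
pose H l (x : 'rV[R]_m) t := section_path (sigma l) (torus x) (pos l).2 (time l t).
pose V l := torus @^-1` U l.
have Hcircle l x t : on_circle (H l x t) by exact: on_circle_section_path.
have oV l : open (V l).
  by apply: open_comp; [move=> + _; exact: torus_continuous | exact: oU].
have Hcont l x t : V l x -> {for (x, t), continuous (fun z => H l z.1 z.2)}.
  move=> Vx; have h1 : torus z.1 @[z --> (x, t)] --> torus x.
    by apply: (@cvg_comp _ _ _ fst torus _ (nbhs x)); [exact: cvg_fst | exact: torus_continuous].
  have h2 : time l z.2 @[z --> (x, t)] --> time l t.
    by apply: (@cvg_comp _ _ _ snd (time l) _ (nbhs t)); [exact: cvg_snd | exact: time_segment_continuous].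
  apply: (@cvg_comp _ _ _ (fun z => (torus z.1, time l z.2))
    (fun z => section_path (sigma l) z.1 (pos l).2 z.2) _ (nbhs (torus x, time l t))).
    exact: (cvg_pair h1 h2).
  exact: section_path_continuous.
have Vcover x : exists l, V l x.
  by have : setT (torus x) by []; rewrite -cU => -[l _]; exists l.
have Vper l (x y : 'rV[R]_m) : (forall i, cis (x 0 i) = cis (y 0 i)) -> V l x -> V l y.
  by rewrite /V /preimage /= => /torus_periodic ->.
have Hper l (x y : 'rV[R]_m) t : (forall i, cis (x 0 i) = cis (y 0 i)) -> H l x t = H l y t.
  by rewrite /H => /torus_periodic ->.
have [e /andP[e_gt0 e_le] Hunif] :=
  uniformly_contracted Hcircle oV Hcont Vcover Vper Hper.
have stop l x k : V l x ->
    section_path (sigma l) (torus x) (pos l).2 (stop_time R k) =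
    set_val (torus_coord x k (pos l).2).
  move=> Vx; rewrite /section_path; case: pselect => // Ux.
  by rewrite /config_point -[X in set_val X (pos l).2]/(path_eval s _ k) sigmaE.
apply: (@no_uniform_contraction R m H
  (fun l => set_val (base (home (pos l).2) (pos l).2)) e) => // x.
have [l lP] := Hunif x; exists l => y z xy xz.
have V1 : V l y by have [] := lP 0 _ y z xy xz; rewrite ?lexx ?ler01.
split.
- by rewrite /H /time time_segment0 stop// torus_coord_base// => l'; exact: pos_home.
- by rewrite /H /time time_segment1 stop// torus_coord_pos.
- by move=> t t' t01 _ tt'; have [_] := lP t t01 y z xy xz; exact.
Qed.

End Planner.

(* [pos] enumerates the free coordinates; [home i] is a factor in which the
   coordinate i is frozen; i1 and i2 are the positions of the two anchors. *)
Lemma frozen_blocks (n s j m : nat) :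
  (2 <= j <= n)%N -> (n <= s * j)%N -> (m <= s * (n - j))%N ->
  exists (pos : 'I_m -> 'I_s * 'I_n) (home : 'I_n -> 'I_s),
    [/\ injective pos,
        forall i l, pos l <> (home i, i) &
        forall k, exists i1 i2, i1 <> i2 /\
          forall l, pos l <> (k, i1) /\ pos l <> (k, i2)].
Proof.
move=> /andP[j2 jn] nsj msq; set q := (n - j)%N in msq.
have j_gt0 : (0 < j)%N by apply: leq_trans j2.
(* Factor [k] freezes the [j] indices from [start k] on; the cap at [q = n - j] keeps the block
   below [n]. [slot k] enumerates the other indices. *)
pose start (k : nat) := minn (k * j) q.
pose slot (k r : nat) := if (r < start k)%N then r else (r + j)%N.
have start_le k : (start k <= q)%N by rewrite geq_minr.
have slotP k r : (slot k r < start k)%N \/ (start k + j <= slot k r)%N.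
  by rewrite /slot; case: (ltnP r (start k)) => h; lia.
have /choice[pos posP] : forall l : 'I_m, exists p : 'I_s * 'I_n,
    p.1 = (l %/ q)%N :> nat /\ p.2 = slot (l %/ q)%N (l %% q)%N :> nat.
  (* If [q = 0] then [m = 0], and there is no [l]. *)
  move=> l; have q0 : (0 < q)%N.
    by case: (posnP q) => // q0; have := ltn_ord l; rewrite q0 in msq *; lia.
  have ks : (l %/ q < s)%N by rewrite ltn_divLR// (leq_trans (ltn_ord l)).
  have rq := ltn_pmod l q0.
  have isl : (slot (l %/ q) (l %% q) < n)%N.
    by rewrite /slot; case: ifP => _; rewrite /q in rq *; lia.
  by exists (Ordinal ks, Ordinal isl).
have homeP (i : 'I_n) : (i %/ j < s)%N.
  by rewrite ltn_divLR// (leq_trans (ltn_ord i)).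
have frozen l (k : 'I_s) (i : 'I_n) :
    (start k <= i < start k + j)%N -> pos l <> (k, i).
  move=> ki pl; have [] := posP l; rewrite pl/= => <- il.
  by have := slotP k (l %% q)%N; rewrite -il; lia.
exists pos, (fun i => Ordinal (homeP i)); split.
- move=> l l' ll'; have [k1 i1] := posP l; have [k2 i2] := posP l'.
  move: k1 i1; rewrite ll' k2 i2 => kk; rewrite kk /slot => ss.
  apply: val_inj => /=; rewrite (divn_eq l q) (divn_eq l' q) kk; congr addn.
  by move: ss; case: (ltnP (l %% q)); case: (ltnP (l' %% q)); lia.
(* Index [i] lies in block [i %/ j], also when that block is capped, since [i < q + j]. *)
- move=> i l; apply: frozen => /=; rewrite /start.
  have := leq_trunc_div i j; have := ltn_ceil i j_gt0; have := ltn_ord i.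
  by rewrite /q; lia.
(* As [j >= 2], a block has room for both anchors at its first two indices. *)
- move=> k; have := start_le k; rewrite /q => sk.
  have h1 : (start k < n)%N by lia.
  have h2 : ((start k).+1 < n)%N by lia.
  exists (Ordinal h1), (Ordinal h2); split; first by case=> /n_Sn.
  by move=> l; split; apply: frozen => /=; lia.
Qed.

Theorem theorem5p6 (R : realType) (a b : circle R) (hab : a <> b)
    (n s j : nat) (hn : (3 <= n)%N) (hs : (2 <= s)%N) (hj : (2 <= j)%N)
    (hnj : Num.ceil (n%:R / j%:R : rat) <= s%:Z) :
  ((s%:R * (n%:R - j%:R))%:E <= TC R s (anchored_config n [set a; b]))%E.
Proof.
have nsj : (n <= s * j)%N.
  move: hnj; rewrite ceil_le_int ler_pdivrMr ?ltr0n ?(leq_trans _ hj)//.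
  by rewrite -[s%:~R]pmulrn -natrM ler_nat.
(* As [TC] subtracts 1 from the infimum, every cover size [m] must be at least s(n-j) + 1. *)
rewrite /TC leeBrDr//; apply: le_ereal_inf_tmp => _ [m [U [oU cU sU]] <-].
rewrite -EFinD lee_fin.
(* If [j > n], then s(n-j) + 1 is negative and the bound is trivial. *)
have [jn|nj] := leqP j n; last first.
  have : (n.+1%:R <= j%:R :> R) by rewrite ler_nat.
  have : (2 <= s%:R :> R) by rewrite ler_nat.
  have : (0 <= m%:R :> R) by [].
  rewrite -natr1; nra.
rewrite -natrB// -natrM natr1 ler_nat ltnNge; apply/negP => msq.
have j2n : (2 <= j <= n)%N by rewrite hj.
have [pos [home [pos_inj pos_home free]]] := frozen_blocks j2n nsj msq.
have /choice[i1 i1P] := free.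
pose base (k : 'I_s) (i : 'I_n) := if i == i1 k then a else b.
have anchored k c : [set a; b] c ->
    exists i, base k i = c /\ forall l, pos l <> (k, i).
  have [i2 [i12 fr]] := i1P k; rewrite /base; case=> ->.
    by exists (i1 k); rewrite eqxx; split=> // l; exact: (fr l).1.
  exists i2; split=> [|l]; last exact: (fr l).2.
  by case: eqP => // e; rewrite e in i12.
exact: (no_torus_planner pos_inj pos_home anchored oU cU sU).
Qed.
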